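(* Suppose $F:L^1(0,T)\to\mathbb R$ is Fréchet differentiable and its derivative $\nabla F:L^1(0,T)\to L^\infty(0,T)$ is Lipschitz continuous with constant $L\ge0$. Let $u\in U_{ad}\cap\mathrm{BV}(0,T)$, $j\in\{2,\dots,d\}$ and $0<t_1<t_2<t_3<t_4<T$ be such that $u=\nu_j$ a.e. on $(t_2,t_3)$ and $u<\nu_j$ a.e. on $(t_1,t_2)\cup(t_3,t_4)$. If \[-2\beta-\int_{t_2}^{t_3}\nabla F(u)(s)\,ds+\frac L2(\nu_j-\nu_{j-1})(t_3-t_2)^2<0,\] then $v:=u+(\nu_{j-1}-\nu_j)\chi_{(t_2,t_3)}$ satisfies $F(v)+\beta\mathrm{TV}(v)<F(u)+\beta\mathrm{TV}(u)$.
   Context: $T>0$, $\beta>0$; $\nu_1<\dots<\nu_d$ are integers. $\mathrm{TV}(u):=\sup\{\int_0^T u\varphi'\,dt : \varphi\in C_c^1(0,T),\ \|\varphi\|_\infty\le 1\}$, $\mathrm{BV}(0,T)=\{u\in L^1(0,T):\mathrm{TV}(u)<\infty\}$. $U_{ad}:=\{u\in L^1(0,T): u(t)\in\{\nu_1,\dots,\nu_d\}\text{ a.e.}\}$. $\nabla F(u)\in L^\infty(0,T)$ denotes the function with $F'(u)h=\int_0^T\nabla F(u)h\,dt$ for all $h\in L^1(0,T)$. *)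

(* Defs.v *)
From HB Require Import structures.
From mathcomp Require Import all_boot all_order all_algebra.
From mathcomp Require Import all_classical all_reals all_analysis.
Set Implicit Arguments. Unset Strict Implicit. Unset Printing Implicit Defensive.
Import Order.TTheory GRing.Theory Num.Theory.
Import numFieldNormedType.Exports.
Local Open Scope classical_set_scope.
Local Open Scope ring_scope.

Section Defs.
Variable R : realType.
Notation mu := (@lebesgue_measure R).

(* L^1(0,T): functions integrable on the open interval (0,T);
   only their values on (0,T) matter. *)
Definition isL1 (T : R) (u : R -> R) : Prop :=
  mu.-integrable `]0, T[%classic (EFin \o u).

Definition oitv (T : R) : set R := `]0, T[%classic.

Definition L1norm (T : R) (u : R -> R) : R :=
  fine (\int[mu]_(x in (oitv T)) (`|u x|)%:E)%E.

Definition isLinf (T : R) (g : R -> R) : Prop :=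
  measurable_fun (oitv T) g /\
  exists M : R, {ae mu, forall x, (oitv T) x -> `|g x| <= M}.

(* Frechet differentiability of F on L^1(0,T), with derivative at u
   represented by G u in L^infty: F'(u) h = \int_0^T G u h. *)
Definition frechet_grad (T : R) (F : (R -> R) -> R) (G : (R -> R) -> R -> R)
  : Prop :=
  forall u, isL1 T u ->
    isLinf T (G u) /\
    forall eps : R, 0 < eps -> exists2 delta : R, 0 < delta &
      forall h, isL1 T h -> L1norm T h < delta ->
        `|F (u \+ h) - F u - Rintegral mu (oitv T) (fun x => G u x * h x)|
          <= eps * L1norm T h.

Definition grad_lipschitz (T : R) (G : (R -> R) -> R -> R) (L : R) : Prop :=
  forall u w, isL1 T u -> isL1 T w ->
    {ae mu, forall x, (oitv T) x -> `|G u x - G w x| <= L * L1norm T (u \- w)}.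

(* C_c^1(0,T) test functions (extended by zero) with sup norm <= 1 *)
Definition test_fun (T : R) (phi : R -> R) : Prop :=
  (forall x, derivable phi x 1) /\ continuous (derive1 phi) /\
  (exists a b : R, 0 < a /\ a < b /\ b < T /\
     forall x, ~ (`[a, b]%classic x) -> phi x = 0) /\
  (forall x, `|phi x| <= 1).

Definition TV (T : R) (u : R -> R) : \bar R :=
  ereal_sup [set (Rintegral mu (oitv T) (fun x => u x * derive1 phi x))%:E
            | phi in test_fun T].

Definition isBV (T : R) (u : R -> R) : Prop :=
  isL1 T u /\ (TV T u < +oo)%E.

(* U_ad, with integers nu_1 < ... < nu_d (1-based indexing) *)
Definition Uad (T : R) (d : nat) (nu : nat -> int) (u : R -> R) : Prop :=
  isL1 T u /\
  {ae mu, forall x, (oitv T) x ->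
     exists i : nat, (1 <= i <= d)%N /\ u x = (nu i)%:~R}.

End Defs.

(* Main.v *)
Require Import Defs.
From HB Require Import structures.
From mathcomp Require Import all_boot all_order all_algebra.
From mathcomp Require Import all_classical all_reals all_analysis.
From mathcomp Require Import measurable_realfun.
From mathcomp Require Import ring lra.
Import Order.TTheory GRing.Theory Num.Theory.
Import numFieldNormedType.Exports.
Local Open Scope classical_set_scope.
Local Open Scope ring_scope.

Set Implicit Arguments.
Unset Strict Implicit.
Unset Printing Implicit Defensive.

(** Write [a := nu_j - nu_(j-1)] and [h := - a * 1_(t2, t3)], so that [v = u + h].
    Along the segment from [u] to [v] the Lipschitz gradient gives
    [F v <= F u - a * int_(t2, t3) G u + L / 2 * (a (t3 - t2))^2]. On the other hand
    [u] takes only the values [nu_i], so [u <= nu_(j-1)] on both flanks of the plateau,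
    and lowering the plateau by [a] lowers the total variation by at least [2 a]: any
    test function for [v] can be changed near [[t2, t3]] into one for [u] with values
    [-1] at [t2] and [1] at [t3], at arbitrarily small cost. The two bounds add up to
    [a] times the left-hand side of the hypothesis, which is negative. *)

(** * Comparison of integrals under almost everywhere bounds *)

Lemma ae_le_integrable (d : measure_display) (X : measurableType d)
    (R : realType) (mu : {measure set X -> \bar R}) (D : set X)
    (f g : X -> R) :
  measurable D -> measurable_fun D f -> mu.-integrable D (EFin \o g) ->
  {ae mu, forall x, D x -> `|f x| <= g x} -> mu.-integrable D (EFin \o f).
Proof.
move=> mD mf ig le_fg; apply/integrableP; split; first exact/measurable_EFinP.
have /integrableP[/measurable_EFinP mg] := ig.
apply: le_lt_trans; apply: ae_ge0_le_integral => //.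
- exact/measurable_EFinP/measurableT_comp.
- exact/measurable_EFinP/measurableT_comp.
- apply: filterS le_fg => x + Dx => /(_ Dx) fg.
  by rewrite lee_fin (le_trans fg)// ler_norm.
Qed.

Lemma ae_le_Rintegral (d : measure_display) (X : measurableType d)
    (R : realType) (mu : {measure set X -> \bar R}) (D : set X)
    (f g : X -> R) :
  measurable D -> mu.-integrable D (EFin \o f) ->
  mu.-integrable D (EFin \o g) ->
  {ae mu, forall x, D x -> f x <= g x} ->
  Rintegral mu D f <= Rintegral mu D g.
Proof.
move=> mD intf intg le_fg; rewrite -subr_ge0 -RintegralB//.
have [/measurable_EFinP mf _] := integrableP _ _ _ intf.
have [/measurable_EFinP mg _] := integrableP _ _ _ intg.
have mgf : measurable_fun D (fun x => g x - f x) by exact: measurable_funB.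
(* [g - f] is nonnegative only almost everywhere; its absolute value is nonnegative everywhere and
   has the same integral. *)
suff -> : Rintegral mu D (fun x => g x - f x) =
          Rintegral mu D (fun x => `|g x - f x|) by exact: Rintegral_ge0.
rewrite /Rintegral; congr fine; apply: ae_eq_integral => //.
- exact/measurable_EFinP.
- exact/measurable_EFinP/measurableT_comp.
- by apply: filterS le_fg => x + Dx => /(_ Dx) fg; rewrite ger0_norm ?subr_ge0.
Qed.

(** * The spaces L^1 and L^infty on the interval *)

Section L1Linf.
Context {R : realType}.
Notation mu := (@lebesgue_measure R).
Implicit Types (T : R) (u h g : R -> R).

Lemma ae_mono (P Q : R -> Prop) :
  {ae mu, forall x, P x} -> (forall x, P x -> Q x) -> {ae mu, forall x, Q x}.
Proof.
by move=> + PQ; apply: filterS => //; exact: (ae_filter_ringOfSetsType mu).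
Qed.

Lemma ae_and (P Q : R -> Prop) :
  {ae mu, forall x, P x} -> {ae mu, forall x, Q x} ->
  {ae mu, forall x, P x /\ Q x}.
Proof.
by move=> aP aQ; apply: filterI => //; exact: (ae_filter_ringOfSetsType mu).
Qed.

Lemma measurable_oitv T : measurable (oitv T : set (measurableTypeR R)).
Proof. exact: measurable_itv. Qed.
Hint Resolve measurable_oitv : core.

Lemma isL1_measurable T u : isL1 T u -> measurable_fun (oitv T) u.
Proof. by move=> /integrableP[/measurable_EFinP]. Qed.

Lemma isL1D T u h : isL1 T u -> isL1 T h -> isL1 T (u \+ h).
Proof.
rewrite /isL1 => iu ih; have := integrableD (measurable_oitv T) iu ih.
exact: eq_integrable.
Qed.

Lemma isL1Z T k h : isL1 T h -> isL1 T (fun x => k * h x).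
Proof.
rewrite /isL1 => ih; have := integrableZl (measurable_oitv T) k ih.
exact: eq_integrable.
Qed.

Lemma isL1M T g h : isLinf T g -> isL1 T h -> isL1 T (fun x => g x * h x).
Proof.
move=> [mg [M gM]] ih.
have mh := isL1_measurable ih.
apply: (@ae_le_integrable _ (measurableTypeR R) R mu (oitv T) _
  (fun x => M * `|h x|)) => //.
- by apply: (@measurable_funM _ (measurableTypeR R)).
- by apply: isL1Z; exact: (@integrable_norm _ (measurableTypeR R)).
- apply: ae_mono gM _ => x + Dx => /(_ Dx) gM.
  by rewrite normrM ler_wpM2r.
Qed.

Lemma L1norm_ge0 T h : 0 <= L1norm T h.
Proof. by apply: fine_ge0; exact: integral_ge0. Qed.

Lemma L1normZ T k h : isL1 T h -> L1norm T (fun x => k * h x) = `|k| * L1norm T h.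
Proof.
move=> ih; rewrite -[RHS]RintegralZl//; last exact: integrable_norm.
by apply: eq_Rintegral => x _; rewrite normrM.
Qed.

Lemma isLinf_continuous T g : continuous g -> isLinf T g.
Proof.
move=> cg; split.
  by apply: measurable_funS (continuous_measurable_fun cg).
have /compact_bounded [M [Mr Mg]] : compact (g @` `[0, T]%classic).
  apply: continuous_compact; last exact: segment_compact.
  exact: continuous_subspaceT.
exists (M + 1); apply: aeW => x Dx; apply: Mg; first by rewrite ltrDl.
by exists x => //; apply: subset_itv_oo_cc.
Qed.

End L1Linf.
#[global] Hint Resolve measurable_oitv : core.

(** * Derivatives along a segment and the descent inequality *)

Lemma is_derive_eps (R : realType) (f : R -> R) (x l : R) :
  (forall eps : R, 0 < eps -> exists2 delta : R, 0 < delta &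
    forall s, `|s| < delta -> `|f (x + s) - f x - s * l| <= eps * `|s|) ->
  is_derive x 1 f l.
Proof.
move=> fl.
have cvfl : (fun s => s^-1 *: (f (s *: 1 + x) - f x)) @ (0 : R)^' --> l.
  apply/cvgrPdist_le => /= e e0; have [delta d0 {}fl] := fl _ e0.
  exists delta => //= s; rewrite /ball_ /= sub0r normrN => sd s0.
  rewrite -[l](mulKf s0) -mulrBr normrM normfV ler_pdivrMl ?normr_gt0//.
  by rewrite [_ *: 1]mulr1 -normrN opprB [s + x]addrC [`|s| * e]mulrC; exact: fl.
by apply: DeriveDef; [exact: cvgP cvfl|exact: cvg_lim cvfl].
Qed.

Section Descent.
Context {R : realType}.
Notation mu := (@lebesgue_measure R).
Variables (T L : R) (F : (R -> R) -> R) (G : (R -> R) -> R -> R).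
Hypotheses (FG : frechet_grad T F G) (GL : grad_lipschitz T G L).
Variables (u h : R -> R).
Hypotheses (u1 : isL1 T u) (h1 : isL1 T h).

Let w t := u \+ (fun x => t * h x).
Let w1 t : isL1 T (w t). Proof. by apply: isL1D => //; exact: isL1Z. Qed.
Let dF t := Rintegral mu (oitv T) (fun x => G (w t) x * h x).

(** The Fréchet expansion at [w t] is applied to the increment [s * h], whose norm is [|s|] times
    that of [h]. *)
Lemma frechet_is_derive (t : R) : is_derive t 1 (F \o w) (dF t).
Proof.
apply: is_derive_eps => eps eps0.
(* Adding 1 keeps the divisor positive when [h] has norm 0. *)
have N1 : 0 < L1norm T h + 1 by rewrite ltr_wpDl ?L1norm_ge0.
have [_ /(_ (eps / (L1norm T h + 1)))] := FG (w1 t).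
rewrite divr_gt0// => /(_ isT)[delta d0 FGd].
exists (delta / (L1norm T h + 1)); first by rewrite divr_gt0.
move=> s; rewrite ltr_pdivlMr// => sd.
have -> : (F \o w) (t + s) = F (w t \+ (fun x => s * h x)).
  by rewrite /=; congr F; apply/funext => x; rewrite /w /= mulrDl addrA.
have /= := FGd _ (isL1Z s h1).
rewrite (L1normZ _ h1).
have sN : `|s| * L1norm T h <= `|s| * (L1norm T h + 1).
  by rewrite ler_wpM2l// lerDl.
move=> /(_ (le_lt_trans sN sd)).
have -> : Rintegral mu (oitv T) (fun x => G (w t) x * (s * h x)) = s * dF t.
  rewrite -RintegralZl//.
    by apply: eq_Rintegral => x _; rewrite mulrCA.
  by apply: isL1M h1; have [] := FG (w1 t).
move=> /le_trans; apply; rewrite -mulrA ler_pM2l//.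
by rewrite ler_pdivrMl// [leRHS]mulrC.
Qed.

(** The points [w t] and [w 0] differ by [t * h], so the gradients differ almost everywhere by at
    most [L * t] times the norm of [h]; multiply by [|h|] and integrate. *)
Lemma grad_increment t : 0 <= t -> dF t <= dF 0 + L * t * L1norm T h ^+ 2.
Proof.
move=> t0; have [gt _] := FG (w1 t); have [g0 _] := FG (w1 0).
have igt : isL1 T (fun x => G (w t) x * h x) by exact: isL1M.
have ig0 : isL1 T (fun x => G (w 0) x * h x) by exact: isL1M.
have inh : isL1 T (fun x => `|h x|) by exact: (@integrable_norm _ (measurableTypeR R)).
have -> : L * t * L1norm T h ^+ 2 =
    Rintegral mu (oitv T) (fun x => L * (t * L1norm T h) * `|h x|).
  by rewrite RintegralZl// /L1norm /Rintegral; ring.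
rewrite /dF -RintegralD//; last exact: isL1Z.
apply: ae_le_Rintegral => //.
  by apply: isL1D => //; exact: isL1Z.
apply: ae_mono (GL (w1 t) (w1 0)) _ => x + Dx => /(_ Dx).
have -> : w t \- w 0 = (fun x => t * h x).
  by apply/funext => y; rewrite /w /=; ring.
rewrite (L1normZ _ h1) (ger0_norm t0) => Gx.
rewrite -lerBlDl -mulrBl (le_trans (ler_norm _))// normrM.
exact: ler_wpM2r.
Qed.

(** The mean value theorem on [[0, 1]] takes the place of integrating the gradient along the
    segment. *)
Lemma descent_lemma : F (u \+ h) <=
  F u + Rintegral mu (oitv T) (fun x => G u x * h x) + L / 2 * L1norm T h ^+ 2.
Proof.
have w0 : w 0 = u by apply/funext => x; rewrite /w/= mul0r addr0.
have w1E : w 1 = u \+ h by apply/funext => x; rewrite /w/= mul1r.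
set N := L1norm T h.
(* [k] is [F] along the segment minus its quadratic model. By [grad_increment] its derivative is
   nonpositive on [[0, 1]], so [k 1 <= k 0], which is the claim. *)
pose k : R -> R :=
  (F \o w) - (dF 0 *: (@id R : R -> R)) -
  ((L / 2 * N ^+ 2) *: ((@id R : R -> R) * (@id R : R -> R))).
have kE t : k t = F (w t) - dF 0 * t - L / 2 * N ^+ 2 * (t * t) by [].
have dk (t : R) : is_derive t 1 k (dF t - dF 0 - L * t * N ^+ 2).
  have Fd := frechet_is_derive t.
  by apply: is_derive_eq; rewrite /GRing.scale /= !mulr1; lra.
have ck : {within `[0, 1]%classic, continuous k}.
  by apply: derivable_within_continuous => x _; exact: (@ex_derive _ _ _ _ _ _ _ (dk x)).
have [c c01] := MVT ltr01 (fun t _ => dk t) ck.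
rewrite subr0 mulr1 !kE w0 w1E => Ek.
have := @grad_increment c; rewrite (itvP c01) => /(_ isT).
have -> : Rintegral mu (oitv T) (fun x => G u x * h x) = dF 0 by rewrite /dF w0.
rewrite -/N; lra.
Qed.

End Descent.

(** * C1 functions with explicit derivatives, and smooth ramps *)

Definition C1_fun {R : realType} (f df : R -> R) : Prop :=
  (forall x : R, is_derive x 1 f (df x)) /\ continuous df.

Section C1.
Context {R : realType}.
Notation mu := (@lebesgue_measure R).
Implicit Types f g df dg : R -> R.

Lemma C1_fun_continuous f df : C1_fun f df -> continuous f.
Proof.
move=> [fd _] x; apply: differentiable_continuous.
by apply/derivable1_diffP; exact: ex_derive.
Qed.

Lemma C1_fun_derive1 f df : C1_fun f df -> f^`()%classic = df.
Proof. by move=> [fd _]; apply/funext => x; rewrite derive1E; exact: derive_val. Qed.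

Lemma C1_cst (c : R) : C1_fun (fun=> c) (fun=> 0).
Proof. by split=> x; [exact: is_derive_cst|exact: cvg_cst]. Qed.

Lemma C1_id : C1_fun (@id R) (fun=> 1).
Proof. by split=> x; [exact: is_derive_id|exact: cvg_cst]. Qed.

Lemma C1_add f df g dg : C1_fun f df -> C1_fun g dg ->
  C1_fun (fun x => f x + g x) (fun x => df x + dg x).
Proof.
move=> [fd cf] [gd cg]; split=> x; last by apply: cvgD; [exact: cf|exact: cg].
exact: is_deriveD.
Qed.

Lemma C1_mul f df g dg : C1_fun f df -> C1_fun g dg ->
  C1_fun (fun x => f x * g x) (fun x => df x * g x + f x * dg x).
Proof.
move=> Hf Hg; have [fd cf] := Hf; have [gd cg] := Hg; split=> x.
  have -> : df x * g x + f x * dg x = f x *: dg x + g x *: df x.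
    by rewrite addrC [g x *: _]mulrC.
  exact: is_deriveM.
apply: cvgD; apply: cvgM; [exact: cf|exact: (C1_fun_continuous Hg)
  |exact: (C1_fun_continuous Hf)|exact: cg].
Qed.

Lemma C1_comp f df g dg : C1_fun f df -> C1_fun g dg ->
  C1_fun (fun x => f (g x)) (fun x => df (g x) * dg x).
Proof.
move=> [fd cf] Hg; have [gd cg] := Hg; split=> x.
  exact: (is_derive1_comp (fd (g x)) (gd x)).
apply: cvgM; last exact: cg.
by apply: continuous_comp; [exact: (C1_fun_continuous Hg)|exact: cf].
Qed.

Lemma FTC_itvoo f df (a b : R) : a < b -> C1_fun f df ->
  Rintegral mu `]a, b[%classic df = f b - f a.
Proof.
move=> ab Hf; have [fd cf] := Hf.
have cdf : {within `[a, b]%classic, continuous df} by exact: continuous_subspaceT.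
have idf : mu.-integrable `[a, b]%classic (EFin \o df).
  by apply: continuous_compact_integrable => //; exact: segment_compact.
have i2 : mu.-integrable `[a, b[%classic (EFin \o df).
  by apply: integrableS idf => //; exact: subset_itv_co_cc.
have i3 : mu.-integrable `]a, b[%classic (EFin \o df).
  by apply: integrableS idf => //; exact: subset_itv_oo_cc.
rewrite Rintegral_itv_obnd_cbnd// Rintegral_itv_bndo_bndc//.
rewrite /Rintegral (@continuous_FTC2 _ _ f)//.
  have cvf x : f y @[y --> x] --> f x by exact: (C1_fun_continuous Hf).
  split=> [x _||]; first exact: ex_derive.
  - exact: cvg_at_right_filter.
  - exact: cvg_at_left_filter.
by move=> x _; rewrite (C1_fun_derive1 Hf).
Qed.

(** The truncated power of degree 2. It is C1, and combinations of its shifts give quadratic splines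
    that serve as cutoffs. *)
Let sqp (x : R) := Num.max x 0 ^+ 2.

Let C1_sqp : C1_fun sqp (fun x => 2 * Num.max x 0).
Proof.
split=> x.
  (* The first-order remainder is at most [s ^+ 2], so [eps] itself serves as [delta]. *)
  apply: is_derive_eps => eps eps0; exists eps => // s se.
  suff : `|sqp (x + s) - sqp x - s * (2 * Num.max x 0)| <= `|s| ^+ 2.
    by move=> /le_trans; apply; rewrite expr2 ler_wpM2r// ltW.
  rewrite real_normK ?num_real// ler_norml /sqp.
  by case: (leP x 0) => x0; case: (leP (x + s) 0) => xs0; apply/andP; split; nra.
apply: cvgM; first exact: cvg_cst.
by apply: continuous_max; [exact: cvg_id|exact: cvg_cst].
Qed.

(* The quadratic spline whose derivative is the tent of height 2 on [0, 1]. *)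
Let step x := 2 * sqp x + (- 4 * sqp (x - 2^-1) + 2 * sqp (x - 1)).
Let dstep (x : R) := 4 * Num.max x 0 + (- 8 * Num.max (x - 2^-1) 0 + 4 * Num.max (x - 1) 0).

Let C1_step : C1_fun step dstep.
Proof.
have sh (k c : R) : C1_fun (fun x => k * sqp (x - c))
    (fun x => 0 * sqp (x - c) + k * (2 * Num.max (x - c) 0 * (1 + 0))).
  apply: C1_mul; first exact: C1_cst.
  by apply: C1_comp C1_sqp _; apply: C1_add C1_id (C1_cst _).
have := C1_add (sh 2 0) (C1_add (sh (- 4) 2^-1) (sh 2 1)).
congr C1_fun; apply/funext => x; rewrite /step /dstep ?subr0//.
by ring.
Qed.

Let stepP x : [/\ 0 <= step x <= 1, 0 <= dstep x,
  x <= 0 -> step x = 0 /\ dstep x = 0 & 1 <= x -> step x = 1 /\ dstep x = 0].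
Proof.
rewrite /step /dstep /sqp.
(* The knots 0, 1/2 and 1 cut the line into pieces on which [step] is quadratic and [dstep] affine;
   contradictory sign patterns are discarded first. *)
case: (leP x 0) => x0; case: (leP (x - 2^-1) 0) => x1; case: (leP (x - 1) 0) => x2;
  (try by exfalso; lra);
  (split; [apply/andP; split; nra|nra|move=> ?; split; nra|move=> ?; split; nra]).
Qed.

(** The spline [step] is carried from [[0, 1]] to [[a, b]] by an affine change of variable. The
    derivative is recorded as 0 at [a] and [b] too, which later settles the endpoints of the
    plateau. *)
Lemma C1_ramp (a b : R) : a < b -> exists f df, [/\ C1_fun f df,
  forall x, 0 <= f x <= 1, forall x, 0 <= df x,
  forall x, x <= a -> f x = 0 /\ df x = 0 &
  forall x, b <= x -> f x = 1 /\ df x = 0].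
Proof.
move=> ab; have ba : 0 < (b - a)^-1 by rewrite invr_gt0 subr_gt0.
pose z x := (x - a) * (b - a)^-1.
have Hz : C1_fun z (fun x => (1 + 0) * (b - a)^-1 + (x - a) * 0).
  by apply: C1_mul (C1_cst _); apply: C1_add C1_id (C1_cst _).
exists (fun x => step (z x)).
exists (fun x => dstep (z x) * ((1 + 0) * (b - a)^-1 + (x - a) * 0)).
split=> [|x|x|x xa|x bx].
- exact: C1_comp.
- by case: (stepP (z x)).
- case: (stepP (z x)) => _ ? _ _; rewrite mulr0 !addr0 mul1r.
  by rewrite mulr_ge0// ltW.
- case: (stepP (z x)) => _ _ + _; case=> [|-> ->]; last by rewrite mul0r.
  by rewrite /z mulr_le0_ge0 ?subr_le0// ltW.
- case: (stepP (z x)) => _ _ _; case=> [|-> ->]; last by rewrite mul0r.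
  by rewrite /z ler_pdivlMr ?subr_gt0// mul1r lerB.
Qed.

End C1.

(** * Test functions and the total variation of a lowered plateau *)

Section TV.
Context {R : realType}.
Notation mu := (@lebesgue_measure R).
Implicit Types (T : R) (f df phi : R -> R).

Lemma test_fun_C1 T phi : test_fun T phi -> C1_fun phi (phi^`()%classic).
Proof.
move=> [dphi [cphi _]]; split=> // x; rewrite derive1E.
by apply: DeriveDef.
Qed.

(** [phi] vanishes at 0 and at [T]. Hence subtracting a constant from a function does not change its
    pairing with a test function. *)
Lemma test_fun_integral0 T phi : test_fun T phi ->
  Rintegral mu (oitv T) phi^`()%classic = 0.
Proof.
move=> Hphi; have [_ [_ [[a [b [a0 [ab [bT phi0]]]]] _]]] := Hphi.
rewrite (FTC_itvoo _ (test_fun_C1 Hphi)) ?phi0 ?subrr//.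
- by rewrite /= in_itv/= => /andP[]; lra.
- by rewrite /= in_itv/= => /andP[]; lra.
- lra.
Qed.

Lemma C1_test_fun T f df a b : C1_fun f df -> 0 < a -> a < b -> b < T ->
  (forall x, x < a -> f x = 0) -> (forall x, b < x -> f x = 0) ->
  (forall x, `|f x| <= 1) -> test_fun T f.
Proof.
move=> Hf a0 ab bT fa fb f1; have [fd cdf] := Hf; split; [|split; [|split]] => //.
- by rewrite (C1_fun_derive1 Hf).
- exists a, b; split=> //; split=> //; split=> // x.
  rewrite /= in_itv/= => /negP; rewrite negb_and -!ltNge => /orP[]; [exact: fa|exact: fb].
Qed.

Lemma Rintegral_mul_indic T (a b : R) f : 0 <= a -> b <= T ->
  Rintegral mu (oitv T) (fun x => f x * \1_(`]a, b[%classic) x) =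
  Rintegral mu `]a, b[%classic f.
Proof.
move=> a0 bT; have -> : `]a, b[%classic = oitv T `&` `]a, b[%classic.
  apply/seteqP; split=> x /=; rewrite /oitv /= !in_itv/=; last by case.
  by move=> /andP[ax xb]; split; apply/andP; split; lra.
rewrite Rintegral_mkcondr; apply: eq_Rintegral => x /set_mem Dx.
rewrite patchE indicE in_setI mem_set//=.
by case: ifP; rewrite ?mulr1 ?mulr0.
Qed.

Lemma isL1_indic T (a b : R) : isL1 T \1_(`]a, b[%classic).
Proof.
apply: (@integrableS _ (measurableTypeR R) R mu setT) => //.
exact: integrable_indic_itv.
Qed.

(** Here [w] stands for [v - m] and [A - c * q] for the change of slope on a flank. The steep part
    [A] has no bound uniform in the ramp width, but it has the sign of [w]; only the bounded part
    [c * q] can cost anything. *)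
Lemma flank_bound (w A c q K C : R) : 0 <= w * A -> 0 <= c <= 1 ->
  `|w| <= K -> `|q| <= C -> - (`|K * C| + 1) <= w * (A - c * q).
Proof.
move=> wA /andP[c0 c1] wK qC.
have : `|w * (c * q)| <= `|K * C|.
  rewrite mulrCA 3!normrM (ger0_norm c0).
  apply: (@le_trans _ _ (`|w| * `|q|)).
    by rewrite ler_piMl ?mulr_ge0.
  apply: ler_pM => //.
    exact: le_trans (ler_norm _).
  exact: le_trans (ler_norm _).
by rewrite mulrBr; move/(le_trans (ler_norm _)); lra.
Qed.

(* [phi] is replaced by a convex combination with a function going from -1 at [t2]
   to 1 at [t3]; on the flanks the new slopes have the sign of [v - m]. *)
Lemma plateau_test_fun T (v : R -> R) (t1 t2 t3 t4 m a K : R) phi (eps : R) :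
  isL1 T v -> 0 < t1 -> t1 < t2 -> t2 < t3 -> t3 < t4 -> t4 < T ->
  {ae mu, forall x, `]t2, t3[%classic x -> v x = m} ->
  {ae mu, forall x, (`]t1, t2[%classic `|` `]t3, t4[%classic) x -> v x <= m} ->
  {ae mu, forall x, oitv T x -> `|v x - m| <= K} ->
  test_fun T phi -> 0 < eps ->
  exists2 psi, test_fun T psi &
    Rintegral mu (oitv T) (fun x => v x * phi^`()%classic x) + 2 * a - eps <=
    Rintegral mu (oitv T)
      (fun x => (v x + a * \1_(`]t2, t3[%classic) x) * psi^`()%classic x).
Proof.
move=> v1 t10 t12 t23 t34 t4T vm vlem vK; move: (t10) (t12) (t23) (t34) (t4T).
rewrite -subr_gt0 -(subr_gt0 t1) -(subr_gt0 t2) -(subr_gt0 t3) -(subr_gt0 t4).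
move=> s10 s12 s23 s34 s4T Hphi eps0; have C1phi := test_fun_C1 Hphi.
have [_ [cphi [[ea [eb [ea0 [eab [ebT phi0]]]]] phi1]]] := Hphi.
have [_ [C phiC]] := isLinf_continuous T cphi.
pose KC : R := `|K * C| + 1.
have KC0 : 0 < KC by rewrite ltr_pwDr.
(* The ramps of width [del] must fit in both flanks, and two intervals of total length [4 * del]
   must cost at most [eps] at rate [KC]. *)
have [del [del0 del12 del34 delE]] : exists del : R,
    [/\ 0 < del, del <= t2 - t1, del <= t4 - t3 & 4 * del * KC <= eps].
  exists (Num.min (eps / (4 * KC)) (Num.min (t2 - t1) (t4 - t3))); split.
  - by rewrite !lt_min divr_gt0 ?mulr_gt0//= s12.
  - by rewrite !ge_min lexx orbT.
  - by rewrite !ge_min lexx !orbT.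
  - set z := Num.min _ _.
    have : z <= eps / (4 * KC) by rewrite /z ge_min lexx.
    by rewrite ler_pdivlMr ?mulr_gt0//; lra.
have t2d : t2 - del < t2 by lra.
have t3d : t3 < t3 + del by lra.
have t20 : 0 <= t2 by rewrite -subr_ge0; lra.
have t3T : t3 <= T by rewrite -subr_ge0; lra.
have [l1 l2] : 0 <= t2 - del /\ 0 <= t3 - del by split; lra.
have [r1 r2] : t2 + del <= T /\ t3 + del <= T by split; lra.
have [b1 b2] : t2 - del < t2 + del /\ t3 - del < t3 + del by split; lra.
(* [f1] rises just before [t2], [f2] just after [t3], and [f3] across the plateau. Thus
   [f1 * (1 - f2)] is a weight equal to 1 on the plateau and 0 at distance [del] from it, while
   [2 * f3 - 1] climbs from -1 to 1. *)
have [f1 [df1 [C1f1 f1b df1p f1l f1r]]] := C1_ramp t2d.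
have [f2 [df2 [C1f2 f2b df2p f2l f2r]]] := C1_ramp t3d.
have [f3 [df3 [C1f3 f3b df3p f3l f3r]]] := C1_ramp t23.
pose psi x := phi x + f1 x * (1 + (- 1) * f2 x) * ((2 * f3 x - 1) + (- 1) * phi x).
(* The derivative is split into the steep slopes of the weight, of order [1 / del], and terms
   bounded independently of [del]. *)
have [dpsi C1psi dpsiE] : exists2 dpsi, C1_fun psi dpsi & forall x, dpsi x =
    phi^`()%classic x + (df1 x * (1 - f2 x) - f1 x * df2 x) * (2 * f3 x - 1 - phi x)
     + f1 x * (1 - f2 x) * (2 * df3 x - phi^`()%classic x).
  eexists.
    apply: C1_add C1phi (C1_mul (C1_mul C1f1 (C1_add (C1_cst _) (C1_mul (C1_cst _) C1f2)))
      (C1_add (C1_add (C1_mul (C1_cst _) C1f3) (C1_cst _)) (C1_mul (C1_cst _) C1phi))).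
  by move=> x /=; ring.
have psiE := C1_fun_derive1 C1psi.
have Hpsi : test_fun T psi.
  apply: (@C1_test_fun _ _ _ (Num.min ea t1) (Num.max eb t4) C1psi).
  - by rewrite lt_min ea0.
  - by rewrite gt_min !lt_max eab.
  - by rewrite gt_max ebT.
  - move=> x; rewrite lt_min => /andP[xa xt].
    rewrite /psi phi0 ?(f1l x _).1; [ring|lra|].
    by rewrite /= in_itv/= => /andP[]; lra.
  - move=> x; rewrite gt_max => /andP[xa xt].
    rewrite /psi phi0 ?(f2r x _).1; [ring|lra|].
    by rewrite /= in_itv/= => /andP[]; lra.
  - move=> x; move: (phi1 x) (f1b x) (f2b x) (f3b x); rewrite !ler_norml.
    move=> /andP[p1 p2] /andP[? ?] /andP[? ?] /andP[? ?].
    rewrite /psi !mulN1r.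
    have e0 : 0 <= f1 x * (1 - f2 x) by apply: mulr_ge0; lra.
    have e1 : f1 x * (1 - f2 x) <= 1 by apply: mulr_ile1; lra.
    move: (f1 x * (1 - f2 x)) e0 e1 => e e0 e1.
    (* [1 - psi] is [(1 - e) * (1 - phi) + 2 * e * (1 - f3)], and [1 + psi] is
       [(1 - e) * (1 + phi) + 2 * e * f3]. *)
    have ep : 0 <= (1 - e) * (1 - phi x) by apply: mulr_ge0; lra.
    have em : 0 <= (1 - e) * (1 + phi x) by apply: mulr_ge0; lra.
    have es : 0 <= e * f3 x by apply: mulr_ge0; lra.
    have et : 0 <= e * (1 - f3 x) by apply: mulr_ge0; lra.
    by apply/andP; split; lra.
exists psi => //.
have iphi := isL1M (isLinf_continuous T cphi) v1.
have cdpsi : continuous (psi^`()%classic) by rewrite psiE; have [] := C1psi.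
have ipsi := isL1M (isLinf_continuous T cdpsi) v1.
have ipsi1 := isL1M (isLinf_continuous T cdpsi) (isL1_indic T t2 t3).
(* The indicator contributes [a * (psi t3 - psi t2)]. The weight is 1 at both ends, so [phi] cancels
   there and the difference is [1 - (-1)]. *)
have Eu : Rintegral mu (oitv T) (fun x =>
      (v x + a * \1_(`]t2, t3[%classic) x) * psi^`()%classic x) =
    Rintegral mu (oitv T) (fun x => psi^`()%classic x * v x) + 2 * a.
  have -> : 2 * a = a * Rintegral mu (oitv T)
      (fun x => psi^`()%classic x * \1_(`]t2, t3[%classic) x).
    rewrite (Rintegral_mul_indic _ t20 t3T) psiE (FTC_itvoo t23 C1psi) /psi.
    rewrite (f1r t2 _).1// (f1r t3 (ltW t23)).1 (f2l t2 (ltW t23)).1.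
    by rewrite (f2l t3 _).1// (f3l t2 _).1// (f3r t3 _).1//; ring.
  rewrite -RintegralZl// -RintegralD//; last exact: isL1Z.
  by apply: eq_Rintegral => x _; ring.
have Ephi : Rintegral mu (oitv T) (fun x => v x * phi^`()%classic x) =
    Rintegral mu (oitv T) (fun x => phi^`()%classic x * v x).
  by apply: eq_Rintegral => x _; rewrite mulrC.
pose D x := psi^`()%classic x - phi^`()%classic x.
have cD : continuous D by move=> x; apply: cvgB; [exact: cdpsi|exact: cphi].
have i1 : isL1 T (fun=> 1).
  apply: (@integrableS _ (measurableTypeR R) R mu `[0, T]%classic) => //.
    exact: subset_itv_oo_cc.
  apply: continuous_compact_integrable; first exact: segment_compact.
  by apply: continuous_subspaceT => x; exact: cvg_cst.
have iD := isL1M (isLinf_continuous T cD) i1.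
have iDv := isL1M (isLinf_continuous T cD) v1.
(* This zero integral lets [v] be replaced by [v - m] in the difference of the two pairings. *)
have ID0 : Rintegral mu (oitv T) (fun x => D x * 1) = 0.
  have ip g : continuous g -> isL1 T g.
    move=> cg; have := isL1M (isLinf_continuous T cg) i1.
    by under eq_fun do rewrite mulr1.
  under eq_Rintegral do rewrite mulr1.
  rewrite RintegralB//; [|exact: ip|exact: ip].
  by rewrite (test_fun_integral0 Hpsi) (test_fun_integral0 Hphi) subrr.
have IDv : Rintegral mu (oitv T) (fun x => psi^`()%classic x * v x) -
    Rintegral mu (oitv T) (fun x => phi^`()%classic x * v x) =
    Rintegral mu (oitv T) (fun x => D x * v x - m * (D x * 1)).
  rewrite RintegralB//; last exact: isL1Z.
  rewrite RintegralZl// ID0 mulr0 subr0 -RintegralB//.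
  by apply: eq_Rintegral => x _; rewrite /D mulrBl.
(* Each ramp fills only the outer half of its interval; the symmetric open intervals also cover the
   points [t2] and [t3]. *)
pose I1 : R -> R := \1_(`](t2 - del), (t2 + del)[%classic).
pose I2 : R -> R := \1_(`](t3 - del), (t3 + del)[%classic).
have iI1 : isL1 T (fun x => 1 * I1 x).
  by under eq_fun do rewrite mul1r; exact: isL1_indic.
have iI2 : isL1 T (fun x => 1 * I2 x).
  by under eq_fun do rewrite mul1r; exact: isL1_indic.
have II : Rintegral mu (oitv T) (fun x => - KC * (1 * I1 x + 1 * I2 x)) = - (4 * del * KC).
  rewrite RintegralZl//; last exact: isL1D.
  rewrite RintegralD// (Rintegral_mul_indic _ l1 r1) (Rintegral_mul_indic _ l2 r2).
  by rewrite (FTC_itvoo b1 C1_id) (FTC_itvoo b2 C1_id); ring.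
rewrite Eu Ephi; set A := Rintegral _ _ _; set B := Rintegral _ _ _.
suff : - (4 * del * KC) <= B - A.
  by move: A B (4 * del * KC) delE => A B k ke kBA; clear -ke kBA; lra.
rewrite IDv -II; apply: ae_le_Rintegral => //.
- by apply: isL1Z; exact: isL1D.
- by apply: isL1D => //; under eq_fun do rewrite -mulNr; exact: isL1Z.
apply: ae_mono (ae_and (ae_and vm vlem) (ae_and vK phiC)) _.
move=> x [[vmx vlemx] [vKx phiCx]] Tx; move: (vKx Tx) (phiCx Tx) => {}vKx {}phiCx.
have -> : D x * v x - m * (D x * 1) = (v x - m) * D x by ring.
have I10 : 0 <= I1 x by rewrite /I1 indicE.
have I20 : 0 <= I2 x by rewrite /I2 indicE.
have bound0 (y : R) : y = 0 -> - KC * (1 * I1 x + 1 * I2 x) <= y.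
  by move=> ->; rewrite !mul1r mulNr oppr_le0 mulr_ge0 ?addr_ge0// ltW.
have bound1 (y : R) : 1 <= I1 x + I2 x -> - KC <= y ->
    - KC * (1 * I1 x + 1 * I2 x) <= y.
  move=> I12; apply: le_trans; rewrite !mul1r mulNr lerN2.
  by rewrite ler_peMr// ltW.
have DE : D x = (df1 x * (1 - f2 x) - f1 x * df2 x) * (2 * f3 x - 1 - phi x)
     + f1 x * (1 - f2 x) * (2 * df3 x - phi^`()%classic x).
  by rewrite /D psiE dpsiE; ring.
have := phi1 x; rewrite ler_norml => /andP[phil phir].
(* Beyond the ramps [D] vanishes, and inside the plateau [v - m] does; the only loss is on the two
   ramp intervals. *)
have [xt2|xt2] := leP x t2.
  have xt3 : x <= t3 := le_trans xt2 (ltW t23).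
  have [F2 dF2] := f2l x xt3; have [F3 dF3] := f3l x xt2.
  have [xd|xd] := leP x (t2 - del).
    have [F1 dF1] := f1l x xd.
    by apply: bound0; rewrite DE F1 dF1; ring.
  apply: bound1.
    by rewrite ler_wpDr// /I1 indicE mem_set//= in_itv/= xd (le_lt_trans xt2)// ltrDl.
  have -> : D x = - df1 x * (1 + phi x) - f1 x * phi^`()%classic x.
    by rewrite DE F2 dF2 F3 dF3; ring.
  apply: flank_bound => //.
  (* The flank gives the sign of [v - m] only for [x < t2]; at [t2] itself the slope [df1] is 0. *)
  have [xt2'|xt2'] := ltP x t2; last first.
    by rewrite (f1r x xt2').2 oppr0 mul0r mulr0.
  have vx : v x <= m.
    apply: vlemx; left; rewrite /= in_itv/= xt2' andbT.
    by apply: le_lt_trans xd; rewrite lerBrDr addrC -lerBrDr.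
  rewrite mulNr mulr_le0 ?subr_le0// oppr_le0 mulr_ge0 ?df1p//.
  by rewrite -lerBlDl sub0r.
have [xt3|xt3] := ltP x t3.
  by apply: bound0; rewrite vmx ?subrr ?mul0r//= in_itv/= xt2.
have [F1 dF1] := f1r x (ltW xt2); have [F3 dF3] := f3r x xt3.
have [xd|xd] := leP (t3 + del) x.
  have [F2 dF2] := f2r x xd.
  by apply: bound0; rewrite DE F1 dF1 F2 dF2; ring.
apply: bound1.
  rewrite ler_wpDl// /I2 indicE mem_set//= in_itv/= xd andbT.
  by rewrite (lt_le_trans _ xt3)// ltrBlDr ltrDl.
have -> : D x = - df2 x * (1 - phi x) - (1 - f2 x) * phi^`()%classic x.
  by rewrite DE F1 dF1 F3 dF3; ring.
have /andP[f20 f21] := f2b x.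
apply: flank_bound => //; last by rewrite subr_ge0 f21 lerBlDr lerDl.
have [xt3'|xt3'] := ltP t3 x; last first.
  by rewrite (f2l x xt3').2 oppr0 mul0r mulr0.
have vx : v x <= m.
  apply: vlemx; right; rewrite /= in_itv/= xt3'/=.
  by apply: lt_le_trans xd _; rewrite -lerBrDl.
by rewrite mulNr mulr_le0 ?subr_le0// oppr_le0 mulr_ge0 ?df2p ?subr_ge0.
Qed.
(** Each test function for [v] yields one for the raised function whose pairing is larger by at
    least [2 * a - eps]; let [eps] tend to 0 and take the supremum. *)
Lemma TV_plateau T (v : R -> R) (t1 t2 t3 t4 m a K : R) :
  isL1 T v -> 0 < t1 -> t1 < t2 -> t2 < t3 -> t3 < t4 -> t4 < T ->
  {ae mu, forall x, `]t2, t3[%classic x -> v x = m} ->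
  {ae mu, forall x, (`]t1, t2[%classic `|` `]t3, t4[%classic) x -> v x <= m} ->
  {ae mu, forall x, oitv T x -> `|v x - m| <= K} ->
  (TV T v + (2 * a)%:E <= TV T (fun x => v x + a * \1_(`]t2, t3[%classic) x)%R)%E.
Proof.
move=> v1 t10 t12 t23 t34 t4T vm vlem vK.
rewrite -leeBrDr//; apply: ub_ereal_sup => _ [phi Hphi <-].
apply/lee_addgt0Pr => eps eps0; rewrite -leeBlDr// leeBrDr//.
have [psi Hpsi le_psi] :=
  plateau_test_fun a v1 t10 t12 t23 t34 t4T vm vlem vK Hphi eps0.
apply: (@le_trans _ _ (Rintegral mu (oitv T)
      (fun x => (v x + a * \1_(`]t2, t3[%classic) x) * psi^`()%classic x))%:E).
  by rewrite -EFinB -EFinD lee_fin addrAC.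
by apply: ereal_sup_ubound; exists psi.
Qed.

(** The zero test function is admissible. This excludes the value [-oo] when finiteness of the total
    variation is needed. *)
Lemma TV_ge0 T (u : R -> R) : 0 < T -> (0 <= TV T u)%E.
Proof.
move=> T0; apply: ereal_sup_ubound; exists (fun=> 0).
  by apply: (@C1_test_fun _ _ _ (T / 4) (T / 2) (C1_cst 0)) => //;
    rewrite ?normr0//; lra.
rewrite (C1_fun_derive1 (C1_cst 0)); under eq_Rintegral do rewrite mulr0.
by rewrite Rintegral_cst ?mul0r.
Qed.

End TV.

(** * Lowering the plateau decreases the objective *)

Unset Implicit Arguments.

Theorem theorem3p12 (R : realType) (T beta L : R) (d : nat) (nu : nat -> int)
  (F : (R -> R) -> R) (G : (R -> R) -> R -> R)
  (u : R -> R) (j : nat) (t1 t2 t3 t4 : R) :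
  0 < T -> 0 < beta ->
  (forall i : nat, (1 <= i < d)%N -> nu i < nu i.+1) ->
  frechet_grad T F G -> 0 <= L -> grad_lipschitz T G L ->
  Uad T d nu u -> isBV T u ->
  (2 <= j <= d)%N ->
  0 < t1 -> t1 < t2 -> t2 < t3 -> t3 < t4 -> t4 < T ->
  {ae @lebesgue_measure R, forall x, `]t2, t3[%classic x -> u x = (nu j)%:~R} ->
  {ae @lebesgue_measure R, forall x, (`]t1, t2[%classic `|` `]t3, t4[%classic) x ->
      u x < (nu j)%:~R} ->
  - 2 * beta - Rintegral (@lebesgue_measure R) `]t2, t3[%classic (G u)
    + L / 2 * ((nu j)%:~R - (nu j.-1)%:~R) * (t3 - t2) ^+ 2 < 0 ->
  let v := fun x => u x + ((nu j.-1)%:~R - (nu j)%:~R) * \1_(`]t2, t3[%classic) x in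
  ((F v)%:E + beta%:E * TV T v < (F u)%:E + beta%:E * TV T u)%E.
Proof.
move=> T0 beta0 nu_lt FG _ GL [u1 uU] [_ TVu] /andP[j2 jd].
move=> t10 t12 t23 t34 t4T uj ultj crit; lazy zeta.
set v := fun x => u x + _.
have t20 : 0 <= t2 := ltW (lt_trans t10 t12).
have t3T : t3 <= T := ltW (lt_trans t34 t4T).
set I : R -> R := \1_(`]t2, t3[%classic).
have I1 : isL1 T I := isL1_indic T t2 t3.
pose m : R := (nu j.-1)%:~R.
pose a : R := (nu j)%:~R - m.
have nu_le k l : (1 <= k)%N -> (k <= l)%N -> (l <= d)%N -> nu k <= nu l.
  move=> k1; elim: l => [|l IH]; first by rewrite leqn0 => /eqP ->.
  rewrite leq_eqVlt => /orP[/eqP -> //|]; rewrite ltnS => kl ld.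
  by rewrite (le_trans (IH kl (ltnW ld)))// ltW// nu_lt// (leq_trans k1 kl).
have a0 : 0 < a.
  have jE : j.-1.+1 = j by rewrite prednK// (leq_trans _ j2).
  rewrite subr_gt0 ltr_int -{2}jE nu_lt// jE jd andbT.
  by rewrite -ltnS jE.
have NE : (nu j.-1)%:~R - (nu j)%:~R = - a :> R by rewrite opprB.
have vE x : v x = u x + - a * I x by rewrite /v NE.
have v1 : isL1 T v.
  have -> : v = u \+ (fun x => - a * I x) by apply/funext.
  by apply: isL1D => //; exact: isL1Z.
have IntI : Rintegral (@lebesgue_measure R) (oitv T) (fun x => 1 * I x) = t3 - t2.
  by rewrite (Rintegral_mul_indic _ t20 t3T) (FTC_itvoo t23 C1_id).
have TVuv : (TV T v + (2 * a)%:E <= TV T u)%E.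
  (* [u] is [v] with its plateau raised back from [m] by [a], so [TV_plateau] is applied to [v]. *)
  have -> : u = (fun x => v x + a * I x) by apply/funext => x; rewrite vE; ring.
  (* The sum dominates every [|nu i|] with [i <= d] at once, hence [|u|] almost everywhere. *)
  pose K : R := \sum_(i < d.+1) `|(nu i)%:~R| + `|a| + `|m|.
  apply: (@TV_plateau _ _ _ t1 t2 t3 t4 m a K) => //.
  - apply: ae_mono uj _ => x ux tx.
    by rewrite vE ux// /I indicE mem_set// mulr1 opprB addrC subrK.
  - have T_t x : (`]t1, t2[%classic `|` `]t3, t4[%classic) x -> oitv T x /\ ~ `]t2, t3[%classic x.
      rewrite /oitv /= !in_itv/=; case=> /andP[xl xr]; split.
      + by rewrite (lt_trans t10 xl) (lt_le_trans xr)// (le_trans (ltW t23) t3T).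
      + by rewrite ltNge (ltW xr).
      + by rewrite (le_lt_trans t20 (lt_trans t23 xl)) (lt_trans xr t4T).
      + by rewrite [x < _]ltNge (ltW xl) andbF.
    apply: ae_mono (ae_and ultj uU) _ => x [ultx uUx] tx.
    have [Tx ntx] := T_t x tx; have [i [/andP[i1 id] ui]] := uUx Tx.
    rewrite vE /I indicE memNset// mulr0 addr0.
    have := ultx tx; rewrite ui ltr_int ler_int => nuij.
    (* The levels are discrete: a value [nu i] not above [nu j] but different from it has
       [i <= j - 1], so it is at most [m]. *)
    have ij : (i < j)%N.
      by rewrite ltnNge; apply/negP => ji; move: nuij; rewrite ltNge nu_le// (leq_trans _ j2).
    rewrite nu_le//; last exact: leq_trans (leq_pred _) jd.
    by rewrite -ltnS prednK// (leq_trans _ j2).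
  - apply: ae_mono uU _ => x uUx Tx; have [i [/andP[i1 id] ui]] := uUx Tx.
    rewrite /K (le_trans (ler_normB _ _))// lerD2r vE (le_trans (ler_normD _ _))// lerD//.
      have id1 : (i < d.+1)%N by [].
      by rewrite ui (bigD1 (Ordinal id1))//= lerDl sumr_ge0.
    rewrite normrM normrN ler_piMr// /I indicE.
    by case: (_ \in _); rewrite ?normr1 ?normr0.
(* With [TV T u] finite the last comparison takes place in the reals; for [TV T v] an upper bound
   suffices. *)
have TVfin : TV T u \is a fin_num.
  by rewrite fin_numElt TVu andbT (lt_le_trans _ (TV_ge0 u T0))// ltNyr.
have := descent_lemma FG GL u1 (isL1Z (- a) I1).
have -> : u \+ (fun x => - a * I x) = v by apply/funext.
have -> : L1norm T (fun x => - a * I x) = a * (t3 - t2).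
  rewrite (L1normZ _ I1) normrN gtr0_norm// -IntI; congr (_ * _).
  by apply: eq_Rintegral => x _; rewrite mul1r ger0_norm.
have -> : Rintegral (@lebesgue_measure R) (oitv T) (fun x => G u x * (- a * I x)) =
    - a * Rintegral (@lebesgue_measure R) `]t2, t3[%classic (G u).
  rewrite -(Rintegral_mul_indic (G u) t20 t3T) -RintegralZl//.
    by apply: eq_Rintegral => x _; rewrite mulrCA.
  by apply: isL1M => //; have [] := FG u u1.
move=> Fv.
rewrite -(fineK TVfin) in TVuv *.
move: (fine _) TVuv => r TVuv.
have TVv : (TV T v <= (r - 2 * a)%:E)%E by rewrite EFinB leeBrDr.
apply: (@le_lt_trans _ _ ((F v)%:E + beta%:E * (r - 2 * a)%:E)%E).
  by rewrite leeD2l// lee_pmul2l// lte_fin.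
rewrite -!EFinM -!EFinD lte_fin.
(* Multiplying the hypothesis by [a > 0] turns its quadratic term into
   [L / 2 * (a * (t3 - t2)) ^+ 2], the one in the descent bound. *)
have := crit; rewrite -/m -/a -(pmulr_rlt0 _ a0).
move: (Rintegral _ _ _) Fv => g Fv ag.
nra.
Qed.
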